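(* Let $X$ be a Banach space and let $A$ be a bounded (nonempty) subset of $X$. Then $$\lim_{n\to\infty}\delta_n(A,X)=\beta(A,X)=\lim_{n\to\infty}\delta_n^{(a)}(A,X).$$
   Context: For a subset $A$ of a normed space $X$ and $n\ge 0$, the $n$-th Kolmogorov diameter is $\delta_n(A,X)=\inf_M \sup_{a\in A} d(a,M)$, the infimum running over linear subspaces $M\subset X$ of dimension at most $n$. The $n$-th affine Kolmogorov diameter is $\delta_n^{(a)}(A,X)=\inf_M\sup_{a\in A}d(a,M)$, the infimum running over (nonempty) affine subspaces $M\subset X$ with $\dim M\le n$. Here $d(a,M)=\inf_{m\in M}\|a-m\|$. The ball (Hausdorff) measure of non-compactness of a subset $A$ of a metric space $M$ is $\beta(A,M)=\inf\{b>0 : A\subset\bigcup_{j=1}^n B(m_j;b)\text{ for some } n\in\mathbb{N} \text{ and } m_1,\dots,m_n\in M\}$, where $B(m;b)$ is the ball of radius $b$ centered at $m$. *)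

(* Defs.v *)
From HB Require Import structures.
From mathcomp Require Import all_boot all_order all_algebra.
From mathcomp Require Import all_classical all_reals all_analysis.
From mathcomp Require Export complex.

Set Implicit Arguments.
Unset Strict Implicit.
Unset Printing Implicit Defensive.

Import Order.TTheory GRing.Theory Num.Theory.
Import numFieldNormedType.Exports.

Local Open Scope classical_set_scope.
Local Open Scope ring_scope.

Section LinearSubspaces.
Variables (K : fieldType) (X : lmodType K).

Definition linear_subspace (M : set X) : Prop :=
  M 0 /\ forall (c : K) (x y : X), M x -> M y -> M (c *: x + y).

Definition is_basis (k : nat) (e : 'I_k -> X) (M : set X) : Prop :=
  (forall c : 'I_k -> K, \sum_(i < k) c i *: e i = 0 -> forall i, c i = 0) /\
  M = [set \sum_(i < k) c i *: e i | c in [set: 'I_k -> K]].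

Definition linear_subspace_dim_le (n : nat) (M : set X) : Prop :=
  linear_subspace M /\
  exists k : nat, (k <= n)%N /\ exists e : 'I_k -> X, is_basis e M.

Definition affine_subspace_dim_le (n : nat) (M : set X) : Prop :=
  exists (x0 : X) (V : set X),
    linear_subspace_dim_le n V /\ M = [set x0 + v | v in V].

End LinearSubspaces.

(* Distances, suprema and infima are taken in the extended reals, so that no
   junk value occurs (a supremum may be +oo, the infimum of set0 is +oo). The
   metric [d] is an explicit real-valued function because over R[i] the library
   norm of X takes its values in R[i]. *)
Section Diameters.
Variable R : realType.

Definition dist_to_set (T : Type) (d : T -> T -> R) (a : T) (M : set T)
    : \bar R :=
  ereal_inf [set (d a m)%:E | m in M].

Definition deviation (T : Type) (d : T -> T -> R) (A M : set T) : \bar R :=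
  ereal_sup [set dist_to_set d a M | a in A].

Definition kolmogorov_diameter (K : fieldType) (X : lmodType K)
    (d : X -> X -> R) (n : nat) (A : set X) : \bar R :=
  ereal_inf [set deviation d A M | M in [set M | linear_subspace_dim_le n M]].

Definition affine_kolmogorov_diameter (K : fieldType) (X : lmodType K)
    (d : X -> X -> R) (n : nat) (A : set X) : \bar R :=
  ereal_inf [set deviation d A M | M in [set M | affine_subspace_dim_le n M]].

Definition ball_noncompactness (T : Type) (d : T -> T -> R) (A : set T)
    : \bar R :=
  ereal_inf [set b%:E | b in [set b : R | 0 < b /\
    exists (n : nat) (m : 'I_n -> T),
      A `<=` \bigcup_(j in [set: 'I_n]) [set x | d (m j) x < b]]].

Definition real_norm_dist (X : normedModType R) (x y : X) : R := `|x - y|.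

(* The norm of a complex normed space is a nonnegative element of R[i], that is,
   a real number; [complex.Re] reads it off as an element of R. *)
Definition complex_norm_dist (X : normedModType R[i]) (x y : X) : R :=
  complex.Re `|x - y|.

End Diameters.

(* Main.v *)
(* If finitely many balls of radius b cover A, their centers span a subspace of
   finite dimension within distance b of A.  Conversely, if A is bounded and
   within distance s of an affine subspace of finite dimension, then its points
   have s-approximants in a bounded part of that subspace, which is totally
   bounded, so finitely many balls of radius s + eps cover A.  Both sequences of
   diameters are nonincreasing, so their limits are their infima. *)
Require Import Defs.
From HB Require Import structures.
From mathcomp Require Import all_boot all_order all_algebra.
From mathcomp Require Import finmap all_classical all_reals all_analysis.
From mathcomp Require Import complex.
From mathcomp Require Import lra.
Import Order.TTheory GRing.Theory Num.Theory.
Import numFieldNormedType.Exports.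
Local Open Scope classical_set_scope.
Local Open Scope ring_scope.

(** * Linear spans and their dimension *)

Definition lin_indep {K : fieldType} {X : lmodType K} {k : nat}
    (e : 'I_k -> X) : Prop :=
  forall c : 'I_k -> K, \sum_(i < k) c i *: e i = 0 -> forall i, c i = 0.

Definition lin_span {K : fieldType} {X : lmodType K} {k : nat}
    (e : 'I_k -> X) : set X :=
  [set \sum_(i < k) c i *: e i | c in [set: 'I_k -> K]].

Lemma lin_span_subspace (K : fieldType) (X : lmodType K) (k : nat)
    (e : 'I_k -> X) : linear_subspace (lin_span e).
Proof.
split; first by exists (fun=> 0) => //; rewrite big1 // => i _; rewrite scale0r.
move=> a _ _ [c _ <-] [c' _ <-]; exists (fun i => a * c i + c' i) => //.
rewrite scaler_sumr -big_split /=; apply: eq_bigr => i _.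
by rewrite scalerDl scalerA.
Qed.

Lemma mem_lin_span (K : fieldType) (X : lmodType K) (k : nat)
    (e : 'I_k -> X) (j : 'I_k) : lin_span e (e j).
Proof.
exists (fun i => (i == j)%:R) => //.
rewrite (bigD1 j) //= eqxx scale1r big1 ?addr0 // => i /negbTE ->.
by rewrite scale0r.
Qed.

(** Induction on the number of vectors: an independent family is already a basis, and otherwise a
    nontrivial relation can be solved for some [m i], which is then dropped without changing the
    span. *)
Lemma lin_span_basis (K : fieldType) (X : lmodType K) (n : nat)
    (m : 'I_n -> X) :
  exists2 k, (k <= n)%N & exists e : 'I_k -> X, is_basis e (lin_span m).
Proof.
elim: n m => [|n IHn] m.
  by exists 0 => //; exists m; split => // c _ [].
have [free_m|/existsNP[c /not_implyP[c0 /existsNP[i /eqP ci]]]] :=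
    pselect (lin_indep m).
  by exists n.+1 => //; exists m.
have [k kn [e eB]] := IHn (fun j => m (lift i j)).
exists k; first exact: leq_trans kn _.
exists e; suff -> : lin_span m = lin_span (fun j => m (lift i j)) by [].
have mi : m i = \sum_j (- (c i)^-1 * c (lift i j)) *: m (lift i j).
  apply: (scalerI ci).
  have sum_split : \sum_j c j *: m j =
      c i *: m i + \sum_j c (lift i j) *: m (lift i j).
    by rewrite (bigD1_ord i).
  move: c0; rewrite sum_split => /eqP.
  rewrite addr_eq0 => /eqP ->; rewrite scaler_sumr -sumrN; apply: eq_bigr => j _.
  by rewrite scalerA mulrA mulrN divff // mulN1r scaleNr.
apply/seteqP; split=> _ [b _ <-].
  exists (fun j => b (lift i j) + b i * (- (c i)^-1 * c (lift i j))) => //.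
  rewrite (bigD1_ord i) //= mi scaler_sumr -big_split /=.
  by apply: eq_bigr => j _; rewrite scalerDl scalerA addrC.
exists (fun j => if unlift i j is Some j' then b j' else 0) => //.
rewrite (bigD1_ord i) //= unlift_none scale0r add0r.
by apply: eq_bigr => j _; rewrite liftK.
Qed.

Lemma lin_span_dim_le (K : fieldType) (X : lmodType K) (n : nat)
    (m : 'I_n -> X) : linear_subspace_dim_le n (lin_span m).
Proof.
split; first exact: lin_span_subspace.
by have [k kn mB] := lin_span_basis K X n m; exists k.
Qed.

(** * Seminorms on abelian groups *)

(* Homogeneity is left out so that real and complex norms share one notion. *)
Definition is_group_seminorm {R : realType} {X : zmodType} (N : X -> R) : Prop :=
  [/\ N 0 = 0, forall x, N (- x) = N x & forall x y, N (x + y) <= N x + N y].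

(** The triangle inequality gives [0 = N (x - x) <= N x + N x]. *)
Lemma group_seminorm_ge0 (R : realType) (X : zmodType) (N : X -> R) (x : X) :
  is_group_seminorm N -> 0 <= N x.
Proof. by case=> N0 NN ND; move: (ND x (- x)); rewrite subrr N0 NN; lra. Qed.

Lemma group_seminorm_sum (R : realType) (X : zmodType) (N : X -> R)
    (I : finType) (f : I -> X) :
  is_group_seminorm N -> N (\sum_i f i) <= \sum_i N (f i).
Proof.
case=> N0 NN ND; elim/big_ind2 : _ => [|x x' y y' xx' yy'|//].
  by rewrite N0.
exact: le_trans (ND _ _) (lerD xx' yy').
Qed.

(** * Norms on the space of real row vectors, compared with the sup norm *)

Section RowNorm.
Context {R : realType} {n : nat} (p : 'rV[R]_n -> R).
Hypothesis p_seminorm : is_group_seminorm p.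
Hypothesis pZ : forall (a : R) x, p (a *: x) = `|a| * p x.

Lemma row_norm_upper : exists2 C, 0 < C & forall x, p x <= C * `|x|.
Proof.
have S0 : 0 <= \sum_(j < n) p (delta_mx 0 j).
  by apply: sumr_ge0 => j _; exact: group_seminorm_ge0.
(* The summand 1 keeps the constant positive even when the sum vanishes. *)
exists (1 + \sum_(j < n) p (delta_mx 0 j)); first by lra.
move=> x; rewrite {1}(row_sum_delta x).
apply: le_trans (group_seminorm_sum _ _ p _ _ p_seminorm) _.
rewrite mulrDl mul1r -[leLHS]add0r lerD // mulr_suml; apply: ler_sum => j _.
rewrite pZ mulrC ler_wpM2l ?group_seminorm_ge0 //.
rewrite [leRHS]/Num.norm /= mx_normrE; apply/bigmax_geP; right => /=.
by exists (0, j).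
Qed.

(** By the reverse triangle inequality and the upper bound, [p] is Lipschitz for the sup norm. *)
Lemma row_norm_continuous : continuous p.
Proof.
have [C C0 pC] := row_norm_upper; have [p0 pN pD] := p_seminorm.
move=> x; apply/(@cvgrPdist_lt _ R^o _ _ (nbhs_filter x)) => e e0.
have eC : 0 < e / C by rewrite divr_gt0.
apply/nbhs_ballP; exists (e / C) => //= y; rewrite -ball_normE /= ltr_pdivlMr // mulrC => xy.
apply: le_lt_trans xy; apply: le_trans (pC _).
have px : p x <= p (x - y) + p y by rewrite -{1}(subrK y x).
have py : p y <= p (x - y) + p x by rewrite -(pN (x - y)) opprB -{1}(subrK x y).
by rewrite ler_norml; lra.
Qed.

Hypothesis p_eq0 : forall x, p x = 0 -> x = 0.

(* By compactness of the unit sphere of the sup norm, p has a positive minimum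
   there. *)
Lemma row_norm_lower : exists2 C, 0 < C & forall x, `|x| <= C * p x.
Proof.
pose S : set 'rV[R]_n := [set x | `|x| = 1].
have normS x : x != 0 -> S (`|x|^-1 *: x).
  by move=> x0; rewrite /S /= normrZ normfV normr_id mulVf ?normr_eq0.
(* If the sphere is empty, every vector is zero and any constant works. *)
have [S0|/set0P/negP/negPn/eqP S0] := pselect (S !=set0); last first.
  exists 1 => // x; have [->|x0] := eqVneq x 0.
    by rewrite normr0 mul1r group_seminorm_ge0.
  by have := normS x x0; rewrite S0.
have cS : compact S.
  apply: bounded_closed_compact.
    by exists 1; split; [exact: num_real|move=> y y1 x /= ->; exact: ltW].
  apply: (@preimage_closed _ _ (fun x : 'rV[R]_n => `|x|) [set 1]).
    by move=> x _; exact: norm_continuous.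
  exact: closed_eq.
have [c cS' pmin] :=
  compact_EVT_min S0 cS (continuous_subspaceT row_norm_continuous).
have pc : 0 < p c.
  rewrite lt_neqAle group_seminorm_ge0 // andbT eq_sym.
  apply/eqP => /p_eq0 c0; move: cS'; rewrite inE c0 /S /= normr0.
  by move/eqP; rewrite eq_sym oner_eq0.
exists (p c)^-1; first by rewrite invr_gt0.
move=> x; have [->|x0] := eqVneq x 0.
  by rewrite normr0 mulr_ge0 ?invr_ge0 ?group_seminorm_ge0.
rewrite ler_pdivlMl //; have := pmin _ (mem_set (normS x x0)).
by rewrite pZ normfV normr_id ler_pdivlMl ?normr_gt0 // mulrC.
Qed.

(** The sublevel set of [p] is bounded by [row_norm_lower] and closed by continuity, hence compact;
    the open [p]-balls of radius [eps] around all points cover it, and a finite subcover supplies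
    the centers. *)
Lemma row_norm_totally_bounded (r eps : R) : 0 < eps ->
  exists (k : nat) (m : 'I_k -> 'rV[R]_n),
    forall x, p x <= r -> exists j, p (x - m j) < eps.
Proof.
move=> eps0; have [C C0 pC] := row_norm_lower; have [p0 pN pD] := p_seminorm.
have : compact [set x | p x <= r].
  apply: bounded_closed_compact.
    exists (C * r); split; first exact: num_real.
    move=> y Cry x /= xr; apply: le_trans (pC x) (le_trans _ (ltW Cry)).
    by rewrite ler_pM2l.
  apply: (@preimage_closed _ _ p [set y | y <= r]).
    by move=> x _; exact: row_norm_continuous.
  exact: closed_le.
rewrite compact_cover => /(_ _ setT
  (fun m : 'rV[R]_n => [set x | p (x - m) < eps])).
case=> [m _||D _ Dcov].
- apply: (@open_comp _ _ (fun x : 'rV[R]_n => p (x - m)) [set y | y < eps]).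
    move=> x _; apply: (@continuous_comp _ _ _ (fun x : 'rV[R]_n => x - m) p).
      by apply: (@continuousB _ _ _ id (cst m));
        [by move=> ?|exact: cst_continuous].
    exact: row_norm_continuous.
  exact: open_lt.
- by move=> x _; exists x => //=; rewrite subrr p0.
exists (size (enum_fset D)), (fun j => nth 0 (enum_fset D) j) => x /Dcov[m mD].
have mD' : (index m (enum_fset D) < size (enum_fset D))%N by rewrite index_mem.
by exists (Ordinal mD'); rewrite /= nth_index.
Qed.

End RowNorm.

(** * Total boundedness of bounded parts of finite-dimensional subspaces *)

(** This isolates what depends on the scalars: it is proved separately over the reals and the
    complex numbers, and the argument on diameters then works over any field [K]. *)
Definition finite_dim_totally_bounded {R : realType} {K : fieldType}
    {X : lmodType K} (N : X -> R) : Prop :=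
  forall (k : nat) (e : 'I_k -> X), lin_indep e ->
  forall r eps : R, 0 < eps -> exists (n : nat) (m : 'I_n -> X),
  forall v, lin_span e v -> N v <= r -> exists j, N (v - m j) < eps.

(** The pullback [N \o phi] is a norm on row vectors, so its finite nets can be pushed forward along
    [phi]. Only real homogeneity of the pullback is asked for, so that real coordinates on a complex
    span qualify. *)
Lemma totally_bounded_of_row (R : realType) (X : zmodType) (N : X -> R)
    (n : nat) (phi : 'rV[R]_n -> X) :
  is_group_seminorm N -> zmod_morphism phi ->
  (forall (a : R) x, N (phi (a *: x)) = `|a| * N (phi x)) ->
  (forall x, N (phi x) = 0 -> x = 0) ->
  forall r eps : R, 0 < eps -> exists (k : nat) (m : 'I_k -> X),
  forall x, N (phi x) <= r -> exists j, N (phi x - m j) < eps.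
Proof.
move=> [N0 NN ND] phiB phiZ phi_eq0 r eps eps0.
have phi0 : phi 0 = 0 by have := phiB 0 0; rewrite !subrr.
have phiN x : phi (- x) = - phi x by rewrite -[- x]sub0r phiB phi0 sub0r.
have p_seminorm : is_group_seminorm (N \o phi).
  split=> [|x|x y] /=; first by rewrite phi0.
    by rewrite phiN NN.
  by rewrite -[y in x + y]opprK phiB phiN opprK.
have [k [m mP]] :=
  row_norm_totally_bounded (N \o phi) p_seminorm phiZ phi_eq0 r eps eps0.
exists k, (phi \o m) => x /mP[j] /=.
by rewrite phiB => ?; exists j.
Qed.

Lemma real_norm_is_group_seminorm (R : realType) (X : normedModType R) :
  is_group_seminorm (fun x : X => `|x|).
Proof. by split=> *; rewrite ?normr0 ?normrN ?ler_normD. Qed.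

(** Apply the transfer to the coordinate map of [e]; independence of [e] makes the pulled-back norm
    definite. *)
Lemma real_finite_dim_totally_bounded (R : realType) (X : normedModType R) :
  finite_dim_totally_bounded (fun x : X => `|x|).
Proof.
move=> k e e_free r eps eps0.
pose phi (x : 'rV[R]_k) := \sum_i x 0 i *: e i.
have [|a x|x /normr0_eq0 /e_free x0|n [m mP]] :=
  totally_bounded_of_row R X _ k phi (real_norm_is_group_seminorm R X) _ _ _
    r eps eps0.
- by move=> x y; rewrite /phi -sumrB; apply: eq_bigr => i _; rewrite !mxE scalerBl.
- rewrite -normrZ /phi scaler_sumr; congr `|_|.
  by apply: eq_bigr => i _; rewrite !mxE scalerA.
- by apply/rowP => i; rewrite mxE.
exists n, m => _ [c _ <-] cr.
have phic : phi (\row_i c i) = \sum_i c i *: e i.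
  by apply: eq_bigr => i _; rewrite mxE.
by rewrite -phic in cr *; exact: mP.
Qed.

Lemma norm_complexE (R : realType) (X : normedModType R[i]) (x : X) :
  `|x| = (complex.Re `|x|)%:C%C.
Proof. by rewrite RRe_real // normr_real. Qed.

Lemma complex_norm_is_group_seminorm (R : realType) (X : normedModType R[i]) :
  is_group_seminorm (fun x : X => complex.Re `|x|).
Proof.
split=> [|x|x y]; rewrite ?normr0 ?normrN //.
have := ler_normD x y.
by rewrite (norm_complexE R X (x + y)) (norm_complexE R X x)
  (norm_complexE R X y) -rmorphD lecR.
Qed.

(* A complex span of k vectors is the image of the real space of dimension
   k + k, by splitting the coefficients into real and imaginary parts. *)
Lemma complex_finite_dim_totally_bounded (R : realType)
    (X : normedModType R[i]) :
  finite_dim_totally_bounded (fun x : X => complex.Re `|x|).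
Proof.
move=> k e e_free r eps eps0.
pose phi (x : 'rV[R]_(k + k)) :=
  \sum_i Complex (x 0 (lshift k i)) (x 0 (rshift k i)) *: e i.
have [|a x|x|n [m mP]] :=
  totally_bounded_of_row R X _ (k + k) phi
    (complex_norm_is_group_seminorm R X) _ _ _ r eps eps0.
- move=> x y; rewrite /phi -sumrB; apply: eq_bigr => i _.
  by rewrite !mxE -scalerBl.
- have -> : phi (a *: x) = a%:C%C *: phi x.
    rewrite /phi scaler_sumr; apply: eq_bigr => i _; rewrite !mxE scalerA.
    by congr (_ *: _); apply/eqP; rewrite eq_complex /= !mul0r subr0 addr0 !eqxx.
  by rewrite normrZ normc_def /= expr0n addr0 sqrtr_sqr
    (norm_complexE R X (phi x)) -rmorphM.
(* A vanishing norm kills each complex coefficient, hence its real part (left half of the row) and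
   its imaginary part (right half). *)
- move=> Nx; have /normr0_eq0/e_free x0 : `|phi x| = 0.
    by rewrite norm_complexE Nx.
  apply/rowP => i; rewrite mxE; case: (split_ordP i) => j ->; have := x0 j.
    by case.
  by case.
exists n, m => _ [c _ <-] cr.
have phic : phi (row_mx (\row_i complex.Re (c i)) (\row_i complex.Im (c i)))
    = \sum_i c i *: e i.
  by apply: eq_bigr => i _; rewrite row_mxEl row_mxEr !mxE; case: (c i).
by rewrite -phic in cr *; exact: mP.
Qed.

(** * Comparison of the diameters with the measure of non-compactness *)

Section Diameters.
Context {R : realType} {K : fieldType} {X : lmodType K} (N : X -> R).
Hypothesis N_seminorm : is_group_seminorm N.
Hypothesis N_totally_bounded : finite_dim_totally_bounded N.
Let d (x y : X) : R := N (x - y).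
Local Open Scope ereal_scope.

Lemma linear_subspace_dim_le_mono (n n' : nat) (M : set X) : (n <= n')%N ->
  linear_subspace_dim_le n M -> linear_subspace_dim_le n' M.
Proof.
move=> nn' [Ml [k [kn eB]]]; split=> //.
by exists k; split=> //; exact: leq_trans nn'.
Qed.

Lemma affine_of_linear (n : nat) (M : set X) :
  linear_subspace_dim_le n M -> affine_subspace_dim_le n M.
Proof.
move=> Mn; exists 0%R, M; split => //; apply/seteqP; split=> [x Mx|_ [x Mx <-]].
  by exists x => //; rewrite add0r.
by rewrite add0r.
Qed.

Lemma kolmogorov_diameter_noninc (A : set X) :
  nonincreasing_seq (fun n => kolmogorov_diameter d n A).
Proof.
move=> n n' nn'; apply: le_ereal_inf => _ [M Mn <-]; exists M => //.
exact: linear_subspace_dim_le_mono Mn.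
Qed.

Lemma affine_kolmogorov_diameter_noninc (A : set X) :
  nonincreasing_seq (fun n => affine_kolmogorov_diameter d n A).
Proof.
move=> n n' nn'; apply: le_ereal_inf => _ [M [x0 [V [Vn ME]]] <-]; exists M => //.
exists x0, V; split => //; exact: linear_subspace_dim_le_mono Vn.
Qed.

Lemma affine_kolmogorov_diameter_le (A : set X) (n : nat) :
  affine_kolmogorov_diameter d n A <= kolmogorov_diameter d n A.
Proof.
by apply: le_ereal_inf => _ [M Mn <-]; exists M => //; exact: affine_of_linear.
Qed.

Lemma dist_to_set_ge0 (a : X) (M : set X) : 0 <= dist_to_set d a M.
Proof.
apply/ereal_infP => _ [m _ <-]; rewrite lee_fin.
exact: (group_seminorm_ge0 _ _ N _ N_seminorm).
Qed.

(** The span of the [n] centers competes in the infimum, and the nearest-center bound already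
    controls the distance to it. *)
Lemma kolmogorov_diameter_le_of_cover (A : set X) (b : R) (n : nat)
    (m : 'I_n -> X) :
  A `<=` \bigcup_(j in [set: 'I_n]) [set x | (d (m j) x < b)%R] ->
  kolmogorov_diameter d n A <= b%:E.
Proof.
move=> Acov; apply: ge_ereal_inf; exists (deviation d A (lin_span m)).
  by exists (lin_span m) => //; exact: lin_span_dim_le.
apply/ereal_supP => _ [a Aa <-]; have [j _ /= ajb] := Acov _ Aa.
apply: ge_ereal_inf; exists (d a (m j))%:E.
  by exists (m j) => //; exact: mem_lin_span.
have [_ NN _] := N_seminorm.
by rewrite lee_fin /d -NN opprB ltW.
Qed.

Lemma noncompactness_le_deviation (A M : set X) (n : nat) :
  (exists r : R, forall a, A a -> (N a <= r)%R) -> A !=set0 ->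
  affine_subspace_dim_le n M -> ball_noncompactness d A <= deviation d A M.
Proof.
move=> [rA ArA] [a0 Aa0] [x0 [V [[_ [k [_ [e [e_free VE]]]]] ->]]].
set D := deviation _ _ _; have [N0 NN ND] := N_seminorm.
have distD a : A a -> dist_to_set d a [set x0 + v | v in V]%R <= D.
  by move=> Aa; apply: ereal_sup_ubound; exists a.
have := le_trans (dist_to_set_ge0 _ _) (distD _ Aa0).
(* The case [+oo] is trivial, and [-oo] is excluded by the nonnegative distance of [a0]. *)
case: D distD => [D|_ _|]; rewrite ?leey //; rewrite lee_fin => distD D0.
apply/lee_addgt0Pr => eps eps0.
(* The radius bounds [N v] whenever [x0 + v] lies within [D + eps / 2] of a point of [A]. One half
   of [eps] pays for an infimum that may not be attained, the other for the net. *)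
have [k' [m mP]] := N_totally_bounded k e e_free (D + eps / 2 + rA + N x0)%R
  (eps / 2)%R ltac:(by rewrite divr_gt0).
apply: ereal_inf_lbound; exists (D + eps)%R => //; split; first by lra.
exists k', (fun j => x0 + m j)%R => a Aa.
have : dist_to_set d a [set x0 + v | v in V]%R < (D + eps / 2)%:E.
  by apply: le_lt_trans (distD _ Aa) _; rewrite lte_fin; lra.
move=> /ereal_inf_lt[_ [_ [v Vv <-] <-]]; rewrite lte_fin /d => av.
have [||j vj] := mP v.
- by move: Vv; rewrite VE.
- have -> : v = (- (a - (x0 + v)) + (a - x0))%R.
    by rewrite opprB addrA subrK addrAC subrr add0r.
  apply: le_trans (ND _ _) _; rewrite NN -!addrA addrA.
  apply: lerD; first exact: ltW.
  by apply: le_trans (ND _ _) _; rewrite NN lerD // ArA.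
exists j => //=.
(* The net error [eps / 2] and the approximation error [D + eps / 2] add up to [D + eps]. *)
have -> : (x0 + m j - a = - (v - m j) - (a - (x0 + v)))%R.
  by rewrite !opprB addrA addrACA addNr addr0 (addrC x0).
apply: le_lt_trans (ND _ _) _; rewrite !NN; lra.
Qed.

Lemma diameters_cvg (A : set X) :
  (exists r : R, forall a, A a -> (N a <= r)%R) -> A !=set0 ->
  kolmogorov_diameter d n A @[n --> \oo] --> ball_noncompactness d A /\
  affine_kolmogorov_diameter d n A @[n --> \oo] --> ball_noncompactness d A.
Proof.
move=> Abd A0.
have lower n : ball_noncompactness d A <= affine_kolmogorov_diameter d n A.
  apply/ereal_infP => _ [M Mn <-].
  exact: noncompactness_le_deviation Mn.
(* One argument serves both sequences: the limit of [u] is its infimum, and a cover by [n] balls of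
   radius [b] forces [u n <= b]. *)
have upper (u : (\bar R)^nat) : nonincreasing_seq u ->
    (forall n, ball_noncompactness d A <= u n) ->
    (forall n, u n <= kolmogorov_diameter d n A) ->
    u @ \oo --> ball_noncompactness d A.
  move=> u_noninc lower_u u_le.
  suff -> : ball_noncompactness d A = ereal_inf (range u).
    exact: ereal_nonincreasing_cvgn.
  apply/eqP; rewrite eq_le; apply/andP; split.
    by apply/ereal_infP => _ [n _ <-].
  apply/ereal_infP => _ [b [b0 [n [m Acov]]] <-].
  apply: le_trans (kolmogorov_diameter_le_of_cover A b n m Acov).
  by apply: le_trans (u_le n); apply: ereal_inf_lbound; exists n.
split; apply: upper => //.
- exact: kolmogorov_diameter_noninc.
- by move=> n; apply: le_trans (lower n) (affine_kolmogorov_diameter_le A n).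
- exact: affine_kolmogorov_diameter_noninc.
- exact: affine_kolmogorov_diameter_le.
Qed.

End Diameters.

Theorem theorem6p9 (R : realType) :
  (forall (X : completeNormedModType R) (A : set X),
     bounded_set A -> A !=set0 ->
     let d := @real_norm_dist R X in
     kolmogorov_diameter d n A @[n --> \oo] --> ball_noncompactness d A /\
     affine_kolmogorov_diameter d n A @[n --> \oo] --> ball_noncompactness d A)
  /\
  (forall (X : completeNormedModType R[i]) (A : set X),
     bounded_set A -> A !=set0 ->
     let d := @complex_norm_dist R X in
     kolmogorov_diameter d n A @[n --> \oo] --> ball_noncompactness d A /\
     affine_kolmogorov_diameter d n A @[n --> \oo] --> ball_noncompactness d A).
Proof.
split=> X A Abd A0 d.
  apply: (diameters_cvg (fun x : X => `|x|)) => //.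
  - exact: real_norm_is_group_seminorm.
  - exact: real_finite_dim_totally_bounded.
  - by have [r _ Ar] := pinfty_ex_gt0 Abd; exists r.
apply: (diameters_cvg (fun x : X => complex.Re `|x|)) => //.
- exact: complex_norm_is_group_seminorm.
- exact: complex_finite_dim_totally_bounded.
(* Here the bound [r] is complex; an inequality in [R[i]] includes the inequality of real parts, so
   [complex.Re r] is a real bound. *)
have [r _ Ar] := pinfty_ex_gt0 Abd; exists (complex.Re r) => a /Ar /=.
by rewrite lecE => /andP[].
Qed.
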